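(* Let $Q,T_1,T_2,X\in\mathcal{B}(\mathcal{H})$ be such that $T_1$, $T_2$ and $T_2Q$ are contractions and $XT_1=T_2QX$. Let $V_1\in\mathcal{B}(\mathcal{K}_1)$ and $V_2\in\mathcal{B}(\mathcal{K}_2)$ be any isometric lifts of $T_1$ and $T_2$ respectively, where $\mathcal{K}_1,\mathcal{K}_2\supseteq\mathcal{H}$. Let $\overline{Q}\in\mathcal{B}(\mathcal{K}_2)$ be any lift of $Q$ such that $V_2\overline{Q}$ is a contraction. Then there is a norm preserving lift $Y:\mathcal{K}_1\to\mathcal{K}_2$ of $X$ such that $YV_1=V_2\overline{Q}Y$.
   Context: All Hilbert spaces are complex; $\mathcal{B}(\mathcal{H})$ is the algebra of bounded linear operators on $\mathcal{H}$; containment of Hilbert spaces means containment as a closed linear subspace; a contraction is an operator of norm at most one. For Hilbert spaces $\mathcal{H}_1\subseteq\mathcal{K}_1$ and $\mathcal{H}_2\subseteq\mathcal{K}_2$, an operator $Y\in\mathcal{B}(\mathcal{K}_1,\mathcal{K}_2)$ is a lift of $X\in\mathcal{B}(\mathcal{H}_1,\mathcal{H}_2)$ if $Y^*h=X^*h$ for all $h\in\mathcal{H}_2$ (so $Y^*$ maps $\mathcal{H}_2$ into $\mathcal{H}_1$); here $\mathcal{H}_1=\mathcal{H}_2=\mathcal{H}$. In particular $B\in\mathcal{B}(\mathcal{K})$ is a lift of $A\in\mathcal{B}(\mathcal{H})$ if $\mathcal{H}$ is invariant under $B^*$ and $B^*|_{\mathcal{H}}=A^*$. An isometric lift is a lift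 that is an isometry; a norm preserving lift $Y$ of $X$ is a lift with $\|Y\|=\|X\|$. *)

(* Defs.v *)
From HB Require Import structures.
From mathcomp Require Import all_boot all_order all_algebra.
From mathcomp Require Import complex.
From mathcomp Require Import all_classical all_reals all_analysis.
From mathcomp Require Import ring lra.

Set Implicit Arguments.
Unset Strict Implicit.
Unset Printing Implicit Defensive.

Import Order.TTheory GRing.Theory Num.Theory.
Import numFieldNormedType.Exports.

Local Open Scope classical_set_scope.
Local Open Scope ring_scope.
Local Open Scope complex_scope.

(* As in [{dot H for Num.conj}], [inner] is linear in its first argument and
   conjugate-linear in its second. *)
HB.mixin Record CompleteNormedModule_isHilbert (R : realType) (H : Type)
    & CompleteNormedModule R[i] H := {
  inner : {dot H for Num.conj} ;
  inner_norm : forall x : H, inner x x = `|x| ^+ 2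
}.

#[short(type="hilbertType")]
HB.structure Definition Hilbert (R : realType) :=
  {H of CompleteNormedModule R[i] H & CompleteNormedModule_isHilbert R H}.

#[short(type="boundedOp")]
HB.structure Definition BoundedOp (R : realType) (H K : hilbertType R) :=
  {A of @GRing.Linear R[i] H K *:%R A & @Continuous H K A}.

HB.instance Definition _ (R : realType) (H K L : hilbertType R)
  (A : boundedOp K L) (B : boundedOp H K) := Continuous.on (A \o B).

Section operators.
Context {R : realType}.
Implicit Types H K : hilbertType R.

(* The values of the norm of [H] are nonnegative elements of [R[i]]; [complex.Re]
   turns them into elements of [R]. *)
Definition opnorm H K (A : H -> K) : R :=
  sup [set complex.Re `|A x| | x in [set x : H | `|x| <= 1]].

Definition contractive H K (A : H -> K) : Prop := opnorm A <= 1.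

Definition isometric H K (A : H -> K) : Prop := forall x : H, `|A x| = `|x|.

(* [adjoint A y] is the vector [z] with [<A x, y> = <x, z>] for all [x]; it is
   unique, and it exists when [A] is bounded and linear, see [adjointP]. *)
Definition adjoint H K (A : H -> K) (y : K) : H :=
  xget 0 [set z : H | forall x : H, inner (A x) y = inner x z].

(* [H1] and [H2] are regarded as closed subspaces of [K1] and [K2] through
   isometric linear embeddings [J1] and [J2]. *)
Definition is_lift (H1 H2 K1 K2 : hilbertType R) (J1 : H1 -> K1) (J2 : H2 -> K2)
    (X : H1 -> H2) (Y : K1 -> K2) : Prop :=
  forall h : H2, adjoint Y (J2 h) = J1 (adjoint X h).

End operators.

Section riesz.
Context {R : realType} {H : hilbertType R}.
Implicit Types x y : H.

Let nr x : R := complex.Re `|x|.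

Let nrC x : (nr x)%:C = `|x|.
Proof.
by rewrite /nr; case: `|x| (normr_ge0 x) => a b; rewrite lecE /= => /andP[/eqP -> _].
Qed.

Let nr_ge0 x : 0 <= nr x.
Proof. by rewrite -lecR nrC normr_ge0. Qed.

Let nrD x y : nr (x + y) <= nr x + nr y.
Proof. by rewrite -lecR rmorphD /= !nrC ler_normD. Qed.

Let nrB x y : `|nr x - nr y| <= nr (x - y).
Proof.
have h a b : nr a - nr b <= nr (a - b) by rewrite lerBlDr -{1}(subrK b a) nrD.
have s : nr (y - x) = nr (x - y) by apply: (@complexI R); rewrite !nrC distrC.
by rewrite ler_norml h andbT -s lerNl opprB h.
Qed.

Let parallelogram x y :
  nr (x + y) ^+ 2 + nr (x - y) ^+ 2 = 2 * (nr x ^+ 2 + nr y ^+ 2).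
Proof.
rewrite mulrDr !mulr_natl; apply: (@complexI R).
rewrite !(rmorphD (real_complex R)) !(rmorphXn (real_complex R)) /= !nrC -!inner_norm.
by rewrite dnormD dnormB; ring.
Qed.

Let project (u v : H) (c : R[i] := inner u v / inner v v) : v != 0 ->
  inner (u - c *: v) (u - c *: v) =
  inner u u - `|inner u v| ^+ 2 / inner v v.
Proof.
rewrite {}/c => v0; have vv : 0 < inner v v by rewrite dnorm_gt0.
have vr : ((inner v v)^*)%R = inner v v by apply/CrealP/ger0_real/ltW.
rewrite dnormB dnormZ linearZr_LR /= !normCK !rmorphM /= !conjCK fmorphV /= vr.
by field; rewrite gt_eqF.
Qed.

Lemma inner_le x y : `|inner x y| <= `|x| * `|y|.
Proof.
have [->|y0] := eqVneq y 0; first by rewrite linear0r !normr0 mulr0.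
have yy : 0 < inner y y by rewrite dnorm_gt0.
rewrite -(@ler_pXn2r _ 2) ?nnegrE ?mulr_ge0 // exprMn -!inner_norm.
have := dnorm_ge0 inner (x - (inner x y / inner y y) *: y).
by rewrite project // subr_ge0 ler_pdivrMr.
Qed.

Variables (f : H -> R[i]) (M : R).
Hypotheses (flin : forall a x y, f (a *: x + y) = a * f x + f y)
  (fM : forall x, `|f x| <= M%:C * `|x|).

Let f0 : f 0 = 0.
Proof. by have := flin (-1) 0 0; rewrite scaler0 addr0 mulN1r addNr. Qed.

Let fZ a x : f (a *: x) = a * f x.
Proof. by have := flin a x 0; rewrite !addr0 f0 addr0. Qed.

Let fD x y : f (x + y) = f x + f y.
Proof. by have := flin 1 x y; rewrite scale1r mul1r. Qed.

Let min_vector : (exists x, f x != 0) ->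
  exists2 e, f e = 1 & forall x, f x = 1 -> nr e ^+ 2 <= nr x ^+ 2.
Proof.
move=> [x0 fx0].
pose S := [set x | f x = 1].
pose D := [set nr x ^+ 2 | x in S].
have Dlb : lbound D 0 by move=> _ [x _ <-]; rewrite exprn_ge0.
have Dinf : has_inf D.
  split; last by exists 0.
  by exists (nr ((f x0)^-1 *: x0) ^+ 2), ((f x0)^-1 *: x0) => //; rewrite /S /= fZ mulVf.
pose d := inf D.
have dle x : S x -> d <= nr x ^+ 2.
  by move=> Sx; apply: (ge_inf Dinf.2); exists x.
have close x y : S x -> S y -> nr (x - y) ^+ 2 <= 2 * (nr x ^+ 2 + nr y ^+ 2) - 4 * d.
  move=> Sx Sy; rewrite -parallelogram.
  have Sm : S (2^-1 *: (x + y)) by rewrite /S /= fZ fD Sx Sy mulVf // pnatr_eq0.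
  have := dle _ Sm.
  have -> : nr (2^-1 *: (x + y)) = 2^-1 * nr (x + y).
    apply: (@complexI R); rewrite rmorphM /= !nrC normrZ ger0_norm ?invr_ge0 ?ler0n //.
    by rewrite fmorphV rmorph_nat.
  rewrite exprMn; lra.
have seqP (n : nat) : exists x, S x /\ nr x ^+ 2 < d + n.+1%:R^-1.
  have n0 : 0 < (n.+1%:R^-1 : R) by rewrite invr_gt0 ltr0n.
  by have [_ [x Sx <-] lt] := inf_adherent n0 Dinf; exists x.
have [u uP] := choice seqP.
have ucauchy : cauchy (u @ \oo).
  apply: cauchy_exP => eps eps0.
  have [e e0 ee] : exists2 e : R, 0 < e & e%:C = eps.
    case: eps eps0 => a b; rewrite ltcE /= => /andP[/eqP -> a0]; by exists a.
  have e4 : 0 < e ^+ 2 / 4 by rewrite divr_gt0 // exprn_gt0.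
  have [N _ NP] : \forall n \near \oo, n.+1%:R^-1 < e ^+ 2 / 4.
    have /cvgrPdist_lt/(_ _ e4) := @cvg_harmonic R.
    apply: filterS => n; rewrite sub0r normrN ger0_norm // /harmonic /= ?invr_ge0 //.
  exists (u N); exists N => // n /= Nn.
  rewrite -ball_normE /= -ee -nrC ltcR -(ltr_pXn2r (n:=2)) ?nnegrE ?(ltW e0) //.
  have := close _ _ (uP N).1 (uP n).1.
  have lin (a b c d1 E p q : R) : a < d1 + p -> b < d1 + q -> p < E / 4 ->
    q < E / 4 -> c <= 2 * (a + b) - 4 * d1 -> c < E by lra.
  exact: lin (uP N).2 (uP n).2 (NP N (leqnn N)) (NP n Nn).
have /cvg_ex[e ue] : cvg (u @ \oo) by exact: cauchy_cvg.
have small eps : 0 < eps -> \forall n \near \oo, nr (e - u n) < eps.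
  move=> eps0; have /cvgrPdist_lt/(_ eps%:C) := ue.
  rewrite ltcR => /(_ eps0); apply: filterS => n.
  by rewrite -nrC ltcR.
have fe : f e = 1.
  apply/eqP; rewrite -subr_eq0 -normr_eq0; apply/negPn/negP => ne0.
  pose r := complex.Re `|f e - 1|.
  have rE : r%:C = `|f e - 1|.
    by rewrite /r; case: `|f e - 1| (normr_ge0 (f e - 1)) => a b; rewrite lecE /= => /andP[/eqP -> _].
  have r0 : 0 < r by rewrite -ltcR rE lt_def ne0 normr_ge0.
  have M1 : 0 < `|M| + 1 by rewrite ltr_wpDl.
  have [N _ /(_ N (leqnn N)) /= hN] := small (r / (`|M| + 1)) (divr_gt0 r0 M1).
  have : r <= M * nr (e - u N).
    rewrite -lecR rmorphM /= nrC rE; apply: le_trans (fM _).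
    by rewrite fD -[- u N]scaleN1r fZ (uP N).1 mulN1r.
  move: hN; rewrite ltr_pdivlMr // => hN hM.
  have := ler_norm M; have := nr_ge0 (e - u N); nra.
exists e => // x Sx.
apply: le_trans (dle _ Sx).
have c1 : (fun n => nr (u n)) @ \oo --> nr e.
  apply/cvgrPdist_lt => eps eps0; apply: filterS (small _ eps0) => n.
  exact/le_lt_trans/nrB.
have c2 : (fun n => nr (u n) ^+ 2) @ \oo --> nr e ^+ 2.
  by under eq_fun do rewrite expr2; rewrite expr2; exact: cvgM.
have c3 : (fun n => d + n.+1%:R^-1) @ \oo --> d.
  by rewrite -[X in _ --> X]addr0; apply: cvgD; [exact: cvg_cst | exact: cvg_harmonic].
rewrite -(cvg_lim _ c2) // -(cvg_lim _ c3) //.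
apply: ler_lim; [exact: cvgP c2 | exact: cvgP c3 |].
by near=> n; apply/ltW; case: (uP n).
Unshelve. all: by end_near. Qed.

Lemma riesz_representation : exists z, forall x, f x = inner x z.
Proof.
have [fn0|] := pselect (exists x, f x != 0); last first.
  move=> h; exists 0 => x; rewrite linear0r; apply/eqP/negPn/negP => fx; apply: h; by exists x.
have [e fe emin] := min_vector fn0.
have orth v : f v = 0 -> inner v e = 0.
  move=> fv; rewrite hermC expr0 mul1r; apply/eqP; rewrite conjC_eq0.
  have [->|v0] := eqVneq v 0; first by rewrite linear0r.
  set c := inner e v.
  have vv : 0 < inner v v by rewrite dnorm_gt0.
  have : inner e e <= inner (e - (c / inner v v) *: v) (e - (c / inner v v) *: v).
    rewrite !inner_norm -!nrC -!rmorphXn lecR; apply: emin.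
    by rewrite fD -scaleNr fZ fv mulr0 addr0.
  rewrite project // -/c lerBrDl gerDr pmulr_lle0 ?invr_gt0 // => h.
  by rewrite -normr_eq0 -sqrf_eq0 eq_le h exprn_ge0.
have e0 : e != 0 by apply/eqP => ez; move: fe; rewrite ez f0 => /esym/eqP; rewrite oner_eq0.
have ee : 0 < inner e e by rewrite dnorm_gt0.
exists ((inner e e)^-1 *: e) => x.
have : inner (- f x *: e + x) e = 0 by apply: orth; rewrite flin fe mulr1 addNr.
rewrite linearDl linearZl_LR mulNr => /eqP; rewrite addrC subr_eq0 => /eqP xe.
have er : ((inner e e)^*)%R = inner e e by apply/CrealP/ger0_real/ltW.
rewrite linearZr_LR /= xe fmorphV /= er.
by rewrite mulrC mulfK ?gt_eqF.
Qed.
End riesz.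

Section bounded.
Context {R : realType} {H K : hilbertType R}.

Lemma boundedOp_bound (A : boundedOp H K) : exists M : R, forall x, `|A x| <= M%:C * `|x|.
Proof.
have : bounded_near A (nbhs (0 : H)) by apply: continuous_linear_bounded; exact: cts_fun.
move=> /linear_boundedP/pinfty_ex_gt0[r r0 rP]; exists (complex.Re r) => x.
have -> : (complex.Re r)%:C = r by rewrite RRe_real ?gtr0_real.
exact: rP.
Qed.

Lemma adjointP (A : boundedOp H K) (x : H) (y : K) :
  inner (A x) y = inner x (adjoint A y).
Proof.
have [M MP] := boundedOp_bound A.
have : exists z, forall x, inner (A x) y = inner x z.
  apply: (@riesz_representation _ _ (fun x => inner (A x) y) (M * complex.Re `|y|)).
    by move=> a u v; rewrite linearP linearDl linearZl_LR.
  move=> u; apply: le_trans (inner_le _ _) _.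
  rewrite rmorphM /= (@RRe_real _ `|y|) ?ger0_real // mulrAC.
  exact: ler_wpM2r.
by move=> /(xgetPex 0).
Qed.
Lemma opnormP (A : boundedOp H K) (x : H) : `|A x| <= (opnorm A)%:C * `|x|.
Proof.
have [M MP] := boundedOp_bound A.
have [->|x0] := eqVneq x 0; first by rewrite linear0 !normr0 mulr0.
have nx : 0 < `|x| by rewrite normr_gt0.
have ReC (z : R[i]) : 0 <= z -> (complex.Re z)%:C = z.
  by case: z => a b; rewrite lecE /= => /andP[/eqP -> _].
have MP' : has_sup [set complex.Re `|A x| | x in [set x : H | `|x| <= 1]].
  split; first by exists (complex.Re `|A 0|), 0; rewrite //= normr0.
  exists `|M| => _ [u /= u1 <-]; rewrite -lecR ReC //.
  apply: le_trans (MP u) _; apply: (@le_trans _ _ (`|M|%:C * `|u|)).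
    by rewrite ler_wpM2r // lecR ler_norm.
  by rewrite ler_piMr // lecR.
have : complex.Re `|A (`|x|^-1 *: x)| <= opnorm A.
  apply: (ub_le_sup MP'.2); exists (`|x|^-1 *: x) => //=.
  by rewrite normrZ normfV normr_id mulVf ?gt_eqF.
rewrite -lecR ReC // linearZ_LR normrZ normfV normr_id mulrC.
by rewrite ler_pdivrMr.
Qed.
End bounded.

(* Main.v *)
Require Import Defs.
From HB Require Import structures.
From mathcomp Require Import all_boot all_order all_algebra.
From mathcomp Require Import complex.
From mathcomp Require Import all_classical all_reals all_analysis.
From mathcomp Require Import ring lra.

Set Implicit Arguments.
Unset Strict Implicit.
Unset Printing Implicit Defensive.

Import Order.TTheory GRing.Theory Num.Theory.
Import numFieldNormedType.Exports.

Local Open Scope classical_set_scope.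
Local Open Scope ring_scope.
Local Open Scope complex_scope.

(** The assertion concerns adjoints: with [Z = Y^*], a lift of [X] is an
    operator [Z : K2 -> K1] with [Z J2 = J1 X^*], and [Y V1 = V2 Qbar Y] reads
    [V1^* Z = Z C] where [C = (V2 Qbar)^*] is a contraction that leaves the
    image of [J2] invariant.  On that image [Z] is prescribed, and there the
    equation holds by the hypothesis on [X].  So an operator that intertwines [C]
    with the coisometry [V1^*] has to be extended from an invariant subspace to
    the whole space without increasing its norm ([intertwining_extension]).
    No dilation is constructed; there are two ingredients.

    The first is Parrott's theorem ([parrott]): an operator into [L] can be
    prescribed at once on a subspace and after composition with a coisometry
    [V^*], as long as the two prescriptions are compatible and both have norm
    at most [g]; the norm of the result is then at most [g].  Starting from any
    extension [Z_0] it yields successive extensions with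
    [V1^* Z_(n+1) = Z_n C].

    The second is averaging ([operator_banach_limit]): a shift-invariant
    limit [Z] of the bounded sequence [Z_n], taken in the weak sense, satisfies
    [V1^* Z = Z C], because both sides are limits of sequences that differ by
    a shift.

    Parrott's theorem rests on the same averaging.  Put [Z = V D + E M],
    where [D] is the prescribed value of [V^* Z], [E] is the part of the prescribed
    operator orthogonal to the range of [V], and [M] is the projection onto the
    subspace for the form [a^2 <x, y> - <D x, D y>].  This form is definite
    when [a > g] ([parrott_approx]); a Banach limit for [a] decreasing
    to [g] does the rest.  The projection [M] solves a fixed-point equation for a
    strict contraction and is, once more, a Banach limit ([neumann]). *)

(** * Banach limits of scalar sequences *)

Section banach_limit.
Context {R : realType}.
Implicit Types (u v : nat -> R) (F : set_system nat).

Definition bounded_seq u := exists M : R, forall n, `|u n| <= M.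

(** The image filter lies in a compact interval, so it clusters at some point;
    for an ultrafilter a cluster point is a limit. *)
Lemma ultrafilter_bounded_cvg F u : UltraFilter F -> bounded_seq u -> cvg (u @ F).
Proof.
move=> FU [M uM].
have FuM : (u @ F) [set` `[- M, M]].
  rewrite /nbhs/=; have -> : u @^-1` [set` `[- M, M]] = setT; last exact: filterT.
  by apply/seteqP; split=> n //= _; rewrite in_itv /= -ler_norml uM.
have [a [_ ua]] := @segment_compact R (- M) M (u @ F) _ FuM.
apply/cvg_ex; exists a => A Aa.
have [//|FnA] := in_ultra_setVsetC (u @^-1` A) FU.
by have [x [/= nAx Ax]] := ua (~` A) A FnA Aa.
Qed.

Let mean u (n : nat) : R := n.+1%:R^-1 * \sum_(i < n.+1) u i.

Let mean_bounded u M n : (forall n, u n <= M) -> mean u n <= M.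
Proof.
move=> uM; rewrite /mean mulrC ler_pdivrMr ?ltr0n // -[n.+1 in leRHS]card_ord.
rewrite mulr_natr -sumr_const; exact: ler_sum.
Qed.

(** Averaging turns a shift into a perturbation that tends to zero; the limit of
    the averages along a free ultrafilter is therefore shift-invariant. *)
Lemma banach_limit_exists : exists lambda : (nat -> R) -> R,
  [/\ forall a u v, bounded_seq u -> bounded_seq v ->
        lambda (fun n => a * u n + v n) = a * lambda u + lambda v,
      forall u, bounded_seq u -> lambda (fun n => u n.+1) = lambda u &
      forall u b, bounded_seq u -> (forall n, u n <= b) -> lambda u <= b].
Proof.
have [F [FU sF]] := @ultraFilterLemma nat \oo _.
have FF := @ultra_proper _ _ FU.
have mean_lin a u v n : mean (fun n => a * u n + v n) n = a * mean u n + mean v n.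
  by rewrite /mean big_split /= -mulr_sumr; ring.
have mean_bnd u : bounded_seq u -> bounded_seq (mean u).
  move=> [M uM]; exists M => n; rewrite ler_norml lerNl; apply/andP; split.
    have -> : - mean u n = mean (fun n => - u n) n by rewrite /mean sumrN mulrN.
    by apply: mean_bounded => i; have := uM i; rewrite ler_norml; lra.
  by apply: mean_bounded => i; have := uM i; rewrite ler_norml; lra.
have mean_cvg u : bounded_seq u -> cvg (mean u @ F).
  by move=> ub; apply: ultrafilter_bounded_cvg => //; exact: mean_bnd.
exists (fun u => lim (mean u @ F)); split.
- move=> a u v ub vb; apply/cvg_lim => //.
  have -> : mean (fun n => a * u n + v n) = (fun n => a * mean u n + mean v n).
    by apply/funext => n; exact: mean_lin.
  by apply: cvgD; [apply: cvgMr|]; exact: mean_cvg.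
- move=> u ub; apply/cvg_lim => //.
  have h : (fun n => mean (fun n => u n.+1) n - mean u n) @ F --> (0 : R).
    apply: cvg_trans (cvg_app _ sF) _.
    have [M uM] := ub.
    have hN n : `|mean (fun n => u n.+1) n - mean u n| <= (2 * M) * n.+1%:R^-1.
      have -> : mean (fun n => u n.+1) n - mean u n = (u n.+1 - u 0%N) * n.+1%:R^-1.
        rewrite /mean big_ord_recr big_ord_recl /= /bump /=.
        under [X in _ - _ * (_ + X)]eq_bigr do rewrite add1n.
        by ring.
      rewrite normrM (ger0_norm (_ : 0 <= n.+1%:R^-1)) ?invr_ge0 //.
      apply: ler_wpM2r; rewrite ?invr_ge0 // (le_trans (ler_normB _ _)) //.
      by have := uM n.+1; have := uM 0%N; lra.
    have c0 : (fun n => (2 * M) * n.+1%:R^-1) @ \oo --> (0 : R).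
      by rewrite -[X in _ --> X](mulr0 (2 * M)); apply: cvgMr; exact: cvg_harmonic.
    apply: norm_cvg0; apply: (squeeze_cvgr _ (cvg_cst 0) c0).
    by apply: nearW => n; rewrite normr_ge0 hN.
  have -> : mean (fun n => u n.+1) =
      (fun n => (mean (fun n => u n.+1) n - mean u n) + mean u n).
    by apply/funext => n; rewrite subrK.
  rewrite -[X in _ --> X]add0r; apply: cvgD => //; exact: mean_cvg.
- move=> u b ub ule; apply: limr_le; first exact: mean_cvg.
  by apply: nearW => n; exact: mean_bounded.
Qed.

End banach_limit.

Section complex_banach_limit.
Context {R : realType}.
Implicit Types (u v : nat -> R[i]) (a c : R[i]).

Definition cbounded_seq u := exists M : R, forall n, `|u n| <= M%:C.

Lemma normc_ge_Im (z : R[i]) : `|complex.Im z|%:C <= `|z|.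
Proof.
rewrite normc_def lecR -sqrtr_sqr ler_sqrt ?addr_ge0 ?sqr_ge0 //.
by rewrite lerDr sqr_ge0.
Qed.

Lemma cbounded_Re u : cbounded_seq u -> bounded_seq (fun n => complex.Re (u n)).
Proof.
by case=> M uM; exists M => n; rewrite -lecR (le_trans (normc_ge_Re _)).
Qed.

Lemma cbounded_Im u : cbounded_seq u -> bounded_seq (fun n => complex.Im (u n)).
Proof.
by case=> M uM; exists M => n; rewrite -lecR (le_trans (normc_ge_Im _)).
Qed.

(** The real functional is applied to real and imaginary parts.  The bound
    on real parts is sharp and controls norms, since [<x, x>] is real; the one on
    moduli, with its factor 2, only serves to see that functionals are bounded. *)
Lemma complex_banach_limit_exists : exists Lambda : (nat -> R[i]) -> R[i],
  [/\ forall a u v, cbounded_seq u -> cbounded_seq v ->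
        Lambda (fun n => a * u n + v n) = a * Lambda u + Lambda v,
      forall u, cbounded_seq u -> Lambda (fun n => u n.+1) = Lambda u,
      forall c, Lambda (fun=> c) = c,
      forall u (b : R), cbounded_seq u -> (forall n, complex.Re (u n) <= b) ->
        complex.Re (Lambda u) <= b &
      forall u (b : R), (forall n, `|u n| <= b%:C) -> `|Lambda u| <= (2 * b)%:C].
Proof.
have [l [llin lshift lle]] := @banach_limit_exists R.
have cst_bounded (c : R) : bounded_seq (fun=> c) by exists `|c|.
have l0 : l (fun=> 0) = 0.
  have := llin (-1) (fun=> 0) (fun=> 0) (cst_bounded 0) (cst_bounded 0).
  by rewrite (_ : (fun _ => _) = fun=> 0); [lra | apply/funext => n; rewrite mulr0 addr0].
have lZ (a : R) (u : nat -> R) : bounded_seq u -> l (fun n => a * u n) = a * l u.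
  move=> ub; have := llin a u (fun=> 0) ub (cst_bounded 0).
  by rewrite l0 addr0 => <-; congr l; apply/funext => n; rewrite addr0.
have lN (u : nat -> R) : bounded_seq u -> l (fun n => - u n) = - l u.
  move=> ub; rewrite -mulN1r -lZ //; congr l; apply/funext => n; by rewrite mulN1r.
have lcst (c : R) : l (fun=> c) = c.
  have [cb cNb] := (cst_bounded c, cst_bounded (- c)).
  by apply/eqP; rewrite eq_le lle //= -lerN2 -lN // lle.
have lb (u : nat -> R) M : (forall n, `|u n| <= M) -> `|l u| <= M.
  move=> uM; have ub : bounded_seq u by exists M.
  rewrite ler_norml lerNl -lN // !lle //.
  - by move=> n; have := uM n; rewrite ler_norml; lra.
  - by exists M => n; rewrite normrN.
  - by move=> n; have := uM n; rewrite ler_norml; lra.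
have lZZ (a b : R) (u v w : nat -> R) : bounded_seq u -> bounded_seq v -> bounded_seq w ->
    l (fun n => a * u n + b * v n + w n) = a * l u + b * l v + l w.
  move=> ub vb wb; have wb' : bounded_seq (fun n => b * v n + w n).
    have [[M vM] [N wN]] := (vb, wb); exists (`|b| * M + N) => n.
    by rewrite (le_trans (ler_normD _ _)) // lerD // normrM ler_wpM2l.
  rewrite -addrA -llin // -llin //; congr l; apply/funext => n; by rewrite addrA.
exists (fun u => (l (fun n => complex.Re (u n)) +i* l (fun n => complex.Im (u n)))); split.
- move=> a u v ub vb.
  have [[[Ru Iu] Rv] Iv] := (cbounded_Re ub, cbounded_Im ub, cbounded_Re vb, cbounded_Im vb).
  have -> : (fun n => complex.Re (a * u n + v n)) =
      (fun n => complex.Re a * complex.Re (u n) + (- complex.Im a) * complex.Im (u n)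
        + complex.Re (v n)).
    by apply/funext => n; case: a (u n) (v n) => [? ?] [? ?] [? ?] /=; ring.
  have -> : (fun n => complex.Im (a * u n + v n)) =
      (fun n => complex.Re a * complex.Im (u n) + complex.Im a * complex.Re (u n)
        + complex.Im (v n)).
    by apply/funext => n; case: a (u n) (v n) => [? ?] [? ?] [? ?] /=; ring.
  rewrite !lZZ //; case: a => [? ?]; simpc; congr (_ +i* _); ring.
- move=> u ub; congr (_ +i* _).
    exact: lshift (cbounded_Re ub).
  exact: lshift (cbounded_Im ub).
- by move=> c; rewrite !lcst; case: c.
- by move=> u b ub ule; apply: lle => //; exact: cbounded_Re.
- move=> u b ule; rewrite [X in `|X|]complexE /=.
  rewrite (le_trans (ler_normD _ _)) // mulr2n mulrDl mul1r rmorphD /= lerD //.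
    rewrite normc_def /= expr0n addr0 sqrtr_sqr lecR lb // => n.
    by rewrite -lecR (le_trans (normc_ge_Re _)).
  rewrite normrM normc_def /= expr0n expr1n add0r sqrtr1 mul1r.
  rewrite normc_def /= expr0n addr0 sqrtr_sqr lecR lb // => n.
  by rewrite -lecR (le_trans (normc_ge_Im _)).
Qed.

End complex_banach_limit.

(** * Norms and inner products *)

Section hilbert.
Context {R : realType}.
Implicit Types H K L : hilbertType R.

(** The norm as a real number: the norm of [H] takes its values in [R[i]], which
    is only partially ordered and out of reach of linear arithmetic. *)
Definition nrm H (x : H) : R := complex.Re `|x|.

Lemma nrmC H (x : H) : (nrm x)%:C = `|x|.
Proof. by rewrite /nrm RRe_real ?ger0_real ?normr_ge0. Qed.

Lemma nrm_ge0 H (x : H) : 0 <= nrm x.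
Proof. by rewrite -lecR nrmC normr_ge0. Qed.

Lemma nrmD H (x y : H) : nrm (x + y) <= nrm x + nrm y.
Proof. by rewrite -lecR rmorphD /= !nrmC ler_normD. Qed.

Lemma nrmZ H (a : R[i]) (x : H) : nrm (a *: x) = complex.Re `|a| * nrm x.
Proof. by apply: (@complexI R); rewrite rmorphM /= !nrmC normrZ.
Qed.

Lemma nrm0 H : nrm (0 : H) = 0.
Proof. by rewrite /nrm normr0. Qed.

Lemma nrm_eq0 H (x : H) : nrm x = 0 -> x = 0.
Proof. by move=> x0; apply/eqP; rewrite -normr_eq0 -nrmC x0. Qed.

Lemma sqr_nrm H (x : H) : nrm x ^+ 2 = complex.Re (inner x x).
Proof. by rewrite inner_norm -nrmC -rmorphXn. Qed.

Lemma innerE H (x : H) : inner x x = (nrm x ^+ 2)%:C.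
Proof. by rewrite inner_norm -nrmC -rmorphXn. Qed.

Lemma inner_nrm_le H (x y : H) : `|inner x y| <= (nrm x * nrm y)%:C.
Proof. by rewrite rmorphM /= !nrmC; exact: inner_le. Qed.

Lemma inner_conj H (x y : H) : inner x y = ((inner y x)^*)%C.
Proof. by rewrite hermC expr0 mul1r. Qed.

Lemma Re_innerC H (x y : H) : complex.Re (inner x y) = complex.Re (inner y x).
Proof. by rewrite inner_conj; case: (inner y x). Qed.

Lemma sqr_nrmD H (x y : H) :
  nrm (x + y) ^+ 2 = nrm x ^+ 2 + nrm y ^+ 2 + 2 * complex.Re (inner x y).
Proof.
rewrite !sqr_nrm linearDl !linearDr /= !raddfD /=.
by rewrite (Re_innerC y x); ring.
Qed.

Lemma Re_inner_le H (x y : H) : complex.Re (inner x y) <= nrm x * nrm y.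
Proof.
rewrite (le_trans (ler_norm _)) // -lecR (le_trans (normc_ge_Re _)) //.
exact: inner_nrm_le.
Qed.

Lemma inner_ext H (x y : H) : (forall l, inner l x = inner l y) -> x = y.
Proof.
move=> xy; apply/eqP; rewrite -subr_eq0 -(dnorm_eq0 inner) linearBr /=.
by rewrite xy subrr.
Qed.

Lemma inner_extl H (x y : H) : (forall l, inner x l = inner y l) -> x = y.
Proof.
by move=> xy; apply: inner_ext => l; rewrite inner_conj xy -inner_conj.
Qed.

Lemma sqr_nrm_le H K (x : H) (y : K) (a : R) : 0 <= a ->
  nrm x <= a * nrm y <-> nrm x ^+ 2 <= a ^+ 2 * nrm y ^+ 2.
Proof.
by move=> a0; rewrite -exprMn ler_pXn2r ?nnegrE ?mulr_ge0 ?nrm_ge0.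
Qed.

Lemma isometric_nrm H K (A : H -> K) : isometric A -> forall x, nrm (A x) = nrm x.
Proof. by move=> Aiso x; rewrite /nrm Aiso. Qed.

Lemma boundedOp_of H K (f : H -> K) (M : R) :
  (forall a x y, f (a *: x + y) = a *: f x + f y) ->
  (forall x, nrm (f x) <= M * nrm x) ->
  exists A : boundedOp H K, (A : H -> K) = f.
Proof.
move=> flin fM.
pose fL : {linear H -> K} := HB.pack f (GRing.isLinear.Build _ _ _ _ f flin).
have fC : continuous f.
  apply: (@bounded_linear_continuous _ H K fL).
  apply/linear_boundedP; near=> r => x.
  rewrite -!nrmC (le_trans (_ : _ <= (M * nrm x)%:C)) ?lecR //.
  rewrite rmorphM /= ler_wpM2r ?lecR ?nrm_ge0 //.
  by near: r; apply: nbhs_pinfty_ge; apply/complex_realP; exists M.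
pose fB : boundedOp H K := HB.pack f (GRing.Linear.class fL) (isContinuous.Build _ _ f fC).
by exists fB.
Unshelve. all: end_near. Qed.

(** The form in which norm bounds come out of inner products by the
    Cauchy-Schwarz inequality: one factor [nrm x] is cancelled. *)
Lemma nrm_le_inner H (x : H) (b : R) :
  complex.Re (inner x x) <= b * nrm x -> 0 <= b -> nrm x <= b.
Proof.
rewrite -sqr_nrm expr2; have := nrm_ge0 x; rewrite le0r => /orP[/eqP ->//|x0].
by rewrite ler_pM2r.
Qed.

End hilbert.

(** * Adjoints and Banach limits of operators *)

Section operators.
Context {R : realType}.
Implicit Types H K L : hilbertType R.

Lemma opnorm_nrm H K (A : boundedOp H K) x : nrm (A x) <= opnorm A * nrm x.
Proof. by rewrite -lecR rmorphM /= !nrmC; exact: opnormP. Qed.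

Lemma opnorm_le H K (A : H -> K) (b : R) : 0 <= b ->
  (forall x, nrm (A x) <= b * nrm x) -> opnorm A <= b.
Proof.
move=> b0 Ab; apply: ge_sup.
  by exists (nrm (A 0)), 0 => //=; rewrite normr0.
move=> _ [x /= x1 <-]; rewrite (le_trans (Ab x)) // ler_piMr //.
by rewrite -lecR nrmC.
Qed.

Lemma opnorm_ge0 H K (A : boundedOp H K) : 0 <= opnorm A.
Proof.
apply: ub_le_sup; last by exists 0; rewrite /= ?normr0 // linear0 normr0.
exists `|opnorm A| => _ [x /= x1 <-]; rewrite (le_trans (opnorm_nrm A x)) //.
rewrite (le_trans (ler_norm _)) // normrM ler_piMr // ger0_norm ?nrm_ge0 //.
by rewrite -lecR nrmC.
Qed.

Lemma adjoint_op_exists H K (A : boundedOp H K) (M : R) : 0 <= M ->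
  (forall x, nrm (A x) <= M * nrm x) ->
  exists B : boundedOp K H, [/\ forall x y, inner (A x) y = inner x (B y),
    forall x y, inner y (A x) = inner (B y) x & forall y, nrm (B y) <= M * nrm y].
Proof.
move=> M0 AM.
have Blin a x y : adjoint A (a *: x + y) = a *: adjoint A x + adjoint A y.
  apply: inner_ext => l; rewrite -adjointP !linearPr /= -!adjointP //.
have BM y : nrm (adjoint A y) <= M * nrm y.
  apply: nrm_le_inner; last by rewrite mulr_ge0 ?nrm_ge0.
  rewrite -adjointP (le_trans (Re_inner_le _ _)) // mulrAC.
  by rewrite ler_wpM2r ?nrm_ge0.
have [B BE] := boundedOp_of Blin BM.
exists B; rewrite BE; split=> // x y; first exact: adjointP.
by rewrite inner_conj adjointP -inner_conj.
Qed.

(** Polarization; replacing [x] by ['i *: x] turns imaginary parts into real ones. *)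
Lemma isometric_inner H K (V : {linear H -> K}) : isometric V ->
  forall x y, inner (V x) (V y) = inner x y.
Proof.
move=> Viso.
have VR x y : complex.Re (inner (V x) (V y)) = complex.Re (inner x y).
  have := sqr_nrmD (V x) (V y); have := sqr_nrmD x y.
  rewrite -linearD /nrm !Viso; lra.
move=> x y; apply/eqP; rewrite eq_complex VR eqxx /=.
have := VR ('i *: x) y.
rewrite linearZ !linearZl_LR /=.
by case: (inner (V x) (V y)) => ? ?; case: (inner x y) => ? ?; simpc => /eqP; rewrite eqr_opp.
Qed.

(** A Banach limit in the weak operator topology: [<l, Z x>] is the limit of
    [<l, Z_n x>], which is a bounded functional of [l] and so given by a vector.
    The first property bounds [Z] by any tail of the sequence.  The second
    says that a recursion between matrix coefficients becomes an equation for
    [Z], by shift invariance; with [l' = 0] it says that a coefficient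
    which is constant along the sequence is kept. *)
Lemma operator_banach_limit H K (Z_ : nat -> boundedOp H K) (M : R) : 0 <= M ->
  (forall n x, nrm (Z_ n x) <= M * nrm x) ->
  exists Z : boundedOp H K,
    (forall N (b : R), 0 <= b -> (forall n x, nrm (Z_ (N + n)%N x) <= b * nrm x) ->
       forall x, nrm (Z x) <= b * nrm x) /\
    (forall x x' l l' c, (forall n, inner l (Z_ n.+1 x) = c + inner l' (Z_ n x')) ->
       inner l (Z x) = c + inner l' (Z x')).
Proof.
move=> M0 ZM.
have [Lam [Llin Lshift Lcst LRe Lle]] := @complex_banach_limit_exists R.
pose u l x n := inner l (Z_ n x).
have ule l x n : `|u l x n| <= (nrm l * (M * nrm x))%:C.
  apply: le_trans (inner_nrm_le _ _) _; rewrite lecR.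
  by rewrite ler_wpM2l ?nrm_ge0.
have ub l x : cbounded_seq (u l x) by exists (nrm l * (M * nrm x)) => n; exact: ule.
have /choice[f fP] x : exists z, forall l, Lam (u l x) = inner l z.
  apply: (@riesz_representation _ _ (fun l => Lam (u l x)) (2 * (M * nrm x))).
    move=> a k l; rewrite -Llin //; congr Lam; apply/funext => n.
    by rewrite /u linearPl.
  move=> l; apply: le_trans (Lle _ _ (ule l x)) _.
  by rewrite -nrmC -rmorphM lecR; have := nrm_ge0 l; lra.
have flin a x y : f (a *: x + y) = a *: f x + f y.
  apply: inner_ext => l; rewrite linearPr /= -!fP -Llin //; congr Lam; apply/funext => n.
  by rewrite /u linearP linearPr.
have fbnd N b : 0 <= b -> (forall n x, nrm (Z_ (N + n)%N x) <= b * nrm x) ->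
       forall x, nrm (f x) <= b * nrm x.
  move=> b0 Zb x; apply: nrm_le_inner; last by rewrite mulr_ge0 ?nrm_ge0.
  have -> : inner (f x) (f x) = Lam (fun n => u (f x) x (N + n)%N).
    rewrite -fP; elim: N {Zb} => [//|N ->]; rewrite -Lshift.
      by congr Lam; apply/funext => n; rewrite addnS addSn.
    by have [B uB] := ub (f x) x; exists B => n.
  apply: LRe; first by have [B uB] := ub (f x) x; exists B => n.
  move=> n; rewrite (le_trans (Re_inner_le _ _)) // mulrC.
  by rewrite ler_wpM2r ?nrm_ge0.
have [Z ZE] := boundedOp_of flin (@fbnd 0%N M M0 ZM).
exists Z; split; first by move=> N b; rewrite ZE; exact: fbnd.
move=> x x' l l' c rec; rewrite ZE -!fP -Lshift //.
have cb : cbounded_seq (fun=> c).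
  by exists (complex.Re `|c|) => n; rewrite RRe_real ?ger0_real ?normr_ge0.
have -> : (fun n => u l x n.+1) = (fun n => 1 * u l' x' n + c).
  by apply/funext => n; rewrite mul1r addrC; exact: rec.
by rewrite Llin // Lcst mul1r addrC.
Qed.

End operators.

(** * Parrott's theorem *)

Section extension.
Context {R : realType}.
Implicit Types H K L : hilbertType R.

Lemma dependent_choice_in (T : Type) (G : T -> Prop) (rel : T -> T -> Prop) z0 : G z0 ->
  (forall z, G z -> exists z', G z' /\ rel z z') ->
  exists s : nat -> T, forall n, G (s n) /\ rel (s n) (s n.+1).
Proof.
move=> Gz0 step.
have /choice[f fP] z : exists z', G z -> G z' /\ rel z z'.
  have [/step[z' ?]|nG] := pselect (G z); first by exists z'.
  by exists z.
have Gs n : G (iter n f z0) by elim: n => //= n /fP[].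
by exists (fun n => iter n f z0) => n; split=> //; have [] := fP _ (Gs n).
Qed.

(** The iterates of [M |-> B + S M] are bounded and each Banach limit of them
    is a fixed point.  Linearity and boundedness of [M] are automatic. *)
Lemma neumann H K (S : boundedOp H H) (B : boundedOp K H) (b c : R) : 0 <= b -> 0 <= c < 1 ->
  (forall x, nrm (S x) <= c * nrm x) -> (forall x, nrm (B x) <= b * nrm x) ->
  exists M : boundedOp K H, forall x, M x = B x + S (M x).
Proof.
move=> b0 /andP[c0 c1] Sc Bb.
have [S' [_ SS' _]] := adjoint_op_exists c0 Sc.
(* the fixed point of m = b + c m, so a bound that the iteration preserves *)
pose m := b / (1 - c).
have m0 : 0 <= m by rewrite divr_ge0 // subr_ge0 ltW.
have mE : b + c * m = m by rewrite /m; field; lra.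
pose G (Z : boundedOp K H) := forall x, nrm (Z x) <= m * nrm x.
pose rel (Z Z' : boundedOp K H) := forall x, Z' x = B x + S (Z x).
have step (Z : boundedOp K H) : G Z -> exists Z', G Z' /\ rel Z Z'.
  move=> GZ.
  have lin a x y : B (a *: x + y) + S (Z (a *: x + y)) =
      a *: (B x + S (Z x)) + (B y + S (Z y)).
    by rewrite !linearP scalerDr addrACA.
  have bnd x : nrm (B x + S (Z x)) <= m * nrm x.
    rewrite -mE mulrDl (le_trans (nrmD _ _)) // lerD // (le_trans (Sc _)) //.
    by rewrite -mulrA ler_wpM2l.
  have [Z' Z'E] := boundedOp_of lin bnd.
  by exists Z'; split=> x; rewrite Z'E.
have BG : G B.
  move=> x; rewrite (le_trans (Bb x)) // ler_wpM2r ?nrm_ge0 // -mE.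
  by rewrite lerDl mulr_ge0.
have [s sP] := dependent_choice_in BG step.
have [M [_ Mrec]] := operator_banach_limit m0 (fun n => (sP n).1).
exists M => x; apply: inner_ext => l.
rewrite linearDr /= SS'; apply: Mrec => n.
by rewrite (sP n).2 linearDr /= SS'.
Qed.

(** [M k] is the projection of [k] onto the image of [J] for the inner product
    [a^2 <x, y> - <D x, D y>].  Its defining orthogonality is the equation
    [M = J^* - s + s J M] with [s = a^-2 J^* D^* D], and [s J] is a strict
    contraction because [g < a]. *)
Lemma penalized_projection H K L (J : boundedOp H K) (D : boundedOp K L) (g a : R) :
  isometric J -> 0 <= g < a -> (forall x, nrm (D x) <= g * nrm x) ->
  exists M : boundedOp K H, forall k h,
    (a ^+ 2)%:C * inner (J h) (k - J (M k)) = inner (D (J h)) (D (k - J (M k))).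
Proof.
move=> Jiso /andP[g0 ga] Dg.
have J1 x : nrm (J x) <= 1 * nrm x by rewrite mul1r isometric_nrm.
have [J' [JJ' _ J'1]] := adjoint_op_exists ler01 J1.
have [D' [DD' _ D'g]] := adjoint_op_exists g0 Dg.
have a0 : 0 < a by exact: le_lt_trans ga.
have a2 : 0 < a ^+ 2 by rewrite exprn_gt0.
pose t : R[i] := ((a ^+ 2)^-1)%:C.
have tE : (a ^+ 2)%:C * t = 1 by rewrite /t -rmorphM divff ?gt_eqF.
pose c := (a ^+ 2)^-1 * g ^+ 2.
have c1 : 0 <= c < 1.
  rewrite /c mulr_ge0 ?invr_ge0 ?sqr_ge0 //= mulrC ltr_pdivrMr // mul1r.
  by rewrite ltr_pXn2r // nnegrE ltW.
pose s k := t *: J' (D' (D k)).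
have slin b x y : s (b *: x + y) = b *: s x + s y.
  by rewrite /s !linearP.
have sB x y : s (x - y) = s x - s y.
  by rewrite addrC -scaleN1r slin scaleN1r addrC.
have sbnd x : nrm (s x) <= c * nrm x.
  rewrite /s nrmZ ger0_norm ?lecR ?invr_ge0 ?sqr_ge0 //= /c -mulrA.
  rewrite ler_wpM2l ?invr_ge0 ?sqr_ge0 // (le_trans (J'1 _)) // mul1r.
  by rewrite (le_trans (D'g _)) // expr2 -mulrA ler_wpM2l.
have sJlin b x y : s (J (b *: x + y)) = b *: s (J x) + s (J y).
  by rewrite linearP slin.
have sJbnd x : nrm (s (J x)) <= c * nrm x.
  by rewrite (le_trans (sbnd _)) // isometric_nrm.
have J'slin b x y : J' (b *: x + y) - s (b *: x + y) = b *: (J' x - s x) + (J' y - s y).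
  by rewrite slin linearP scalerBr opprD addrACA.
have J'sbnd x : nrm (J' x - s x) <= (1 + c) * nrm x.
  rewrite mulrDl (le_trans (nrmD _ _)) // lerD // -scaleN1r nrmZ normrN1 mul1r.
  exact: sbnd.
have [S SE] := boundedOp_of sJlin sJbnd.
have [B BE] := boundedOp_of J'slin J'sbnd.
have Sc x : nrm (S x) <= c * nrm x by rewrite SE.
have B1 x : nrm (B x) <= (1 + c) * nrm x by rewrite BE.
have c10 : 0 <= 1 + c by rewrite addr_ge0 //; case/andP: c1.
have [M MP] := neumann c10 c1 Sc B1.
exists M => k h; set m := M k.
have -> : inner (J h) (k - J m) = inner h (J' k) - inner h m.
  by rewrite linearBr /= JJ' isometric_inner.
have mE : m = J' k - s (k - J m).
  by rewrite {1}/m MP BE SE -/m sB opprB addrAC addrA.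
have -> : inner h (J' k) - inner h m = inner h (s (k - J m)).
  by rewrite -linearBr {1}mE subKr.
rewrite /s linearZr_LR /=.
have -> : (t^*)%R = t by rewrite /t; exact: conjc_real.
by rewrite mulrA tE mul1r -JJ' -DD'.
Qed.

(** With [m = M k], the orthogonality of [V (D k)] and [E m] and the equation
    [|Z0 m|^2 = |D J m|^2 + |E m|^2] give
    [|Z k|^2 = |D k|^2 - |D J m|^2 + |Z0 m|^2], so the bound on [Z k] follows from
    [a^2 |J m|^2 - |D J m|^2 <= a^2 |k|^2 - |D k|^2]: the projection [J m] of [k]
    is no longer than [k] for the form that defines it. *)
Lemma parrott_approx H K L L' (J : boundedOp H K) (V : boundedOp L' L)
    (Z0 : boundedOp H L) (D : boundedOp K L') (g a : R) :
  isometric J -> isometric V -> 0 <= g < a ->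
  (forall h, nrm (Z0 h) <= g * nrm h) -> (forall k, nrm (D k) <= g * nrm k) ->
  (forall h l, inner (V l) (Z0 h) = inner l (D (J h))) ->
  exists Z : boundedOp K L, [/\ forall k, nrm (Z k) <= a * nrm k,
    forall h, Z (J h) = Z0 h & forall k l, inner (V l) (Z k) = inner l (D k)].
Proof.
move=> Jiso Viso ga Z0g Dg compat.
have [M MP] := penalized_projection Jiso ga Dg.
move: ga => /andP[g0 ga].
have a0 : 0 <= a by rewrite (le_trans g0) // ltW.
have g2 : g ^+ 2 < a ^+ 2 by rewrite ltr_pXn2r.
pose E h := Z0 h - V (D (J h)).
have Elin b x y : E (b *: x + y) = b *: E x + E y.
  by rewrite /E (linearP J) (linearP D) (linearP V) (linearP Z0) scalerBr opprD addrACA.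
have VE l h : inner (V l) (E h) = 0.
  by rewrite linearBr /= compat isometric_inner // subrr.
have sqVE x h : nrm (V x + E h) ^+ 2 = nrm x ^+ 2 + nrm (E h) ^+ 2.
  by rewrite sqr_nrmD VE mulr0 addr0 isometric_nrm.
have sqE h : nrm (Z0 h) ^+ 2 = nrm (D (J h)) ^+ 2 + nrm (E h) ^+ 2.
  by rewrite -sqVE /E addrC subrK.
have EZ0 h : V (D (J h)) + E h = Z0 h by rewrite /E addrC subrK.
clearbody E.
have Zlin b x y : V (D (b *: x + y)) + E (M (b *: x + y)) =
    b *: (V (D x) + E (M x)) + (V (D y) + E (M y)).
  by rewrite (linearP D) (linearP V) (linearP M) Elin scalerDr addrACA.
have Zbnd k : nrm (V (D k) + E (M k)) <= a * nrm k.
  apply/sqr_nrm_le => //; rewrite sqVE.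
  set m := M k; set r := k - J m.
  have kE : k = J m + r by rewrite /r addrC subrK.
  have Jm : nrm (J m) = nrm m by exact: isometric_nrm.
  have h1 : nrm (Z0 m) ^+ 2 <= g ^+ 2 * nrm m ^+ 2 by apply/sqr_nrm_le.
  have h2 : nrm (D r) ^+ 2 <= g ^+ 2 * nrm r ^+ 2 by apply/sqr_nrm_le.
  have h3 : a ^+ 2 * complex.Re (inner (J m) r) = complex.Re (inner (D (J m)) (D r)).
    have := MP k m; rewrite -/m -/r => <-.
    by case: (inner _ _) => x y; simpc.
  rewrite {1}kE linearD !sqr_nrmD [in leRHS]kE sqr_nrmD Jm.
  have := sqE m; have := sqr_ge0 (nrm m); have := sqr_ge0 (nrm r); nra.
(* a projection fixes its range: the form is definite, since g < a *)
have MJ h : M (J h) = h.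
  set u := h - M (J h); apply/esym/eqP; rewrite -subr_eq0 -/u; apply/eqP/nrm_eq0.
  have h1 : nrm (D (J u)) ^+ 2 <= g ^+ 2 * nrm u ^+ 2.
    by rewrite -(isometric_nrm Jiso u); apply/sqr_nrm_le.
  have := MP (J h) u; rewrite -linearB -/u !innerE -rmorphM => /complexI.
  rewrite isometric_nrm // => h2; apply/eqP; rewrite -sqrf_eq0; apply/eqP.
  by have := sqr_ge0 (nrm u); nra.
have [Z ZE] := boundedOp_of Zlin Zbnd.
exists Z; rewrite ZE; split=> // [h|k l]; first by rewrite MJ.
by rewrite linearDr /= VE addr0 isometric_inner.
Qed.

(** The constants [g + 1/(n+1)] decrease to [g] and the two prescriptions do not
    depend on [n]; the bound on the limit holds for every tail. *)
Lemma parrott H K L L' (J : boundedOp H K) (V : boundedOp L' L)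
    (Z0 : boundedOp H L) (D : boundedOp K L') (g : R) :
  isometric J -> isometric V -> 0 <= g ->
  (forall h, nrm (Z0 h) <= g * nrm h) -> (forall k, nrm (D k) <= g * nrm k) ->
  (forall h l, inner (V l) (Z0 h) = inner l (D (J h))) ->
  exists Z : boundedOp K L, [/\ forall k, nrm (Z k) <= g * nrm k,
    forall h, Z (J h) = Z0 h & forall k l, inner (V l) (Z k) = inner l (D k)].
Proof.
move=> Jiso Viso g0 Z0g Dg compat.
have ga n : 0 <= g < g + n.+1%:R^-1 by rewrite g0 ltrDl invr_gt0 ltr0n.
have [Z_ Z_P] := choice (fun n => parrott_approx Jiso Viso (ga n) Z0g Dg compat).
have Z_g N n x : nrm (Z_ (N + n)%N x) <= (g + N.+1%:R^-1) * nrm x.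
  have [Zb _ _] := Z_P (N + n)%N.
  rewrite (le_trans (Zb _)) // ler_wpM2r ?nrm_ge0 // lerD2l.
  by rewrite lef_pV2 ?posrE ?ltr0n // ler_nat ltnS leq_addr.
have gN0 N : 0 <= g + N.+1%:R^-1 by have /andP[_ /ltW] := ga N; exact: le_trans.
have [Z [Zbnd Zrec]] := @operator_banach_limit _ _ _ Z_ _ (gN0 0%N) (Z_g 0%N).
exists Z; split.
- move=> k; rewrite leNgt; apply/negP => lt.
  have k0 : 0 < nrm k.
    rewrite lt_def nrm_ge0 andbT; apply/eqP => /nrm_eq0 k0.
    by move: lt; rewrite k0 linear0 !nrm0 mulr0 ltxx.
  move: lt; rewrite -ltr_pdivlMr // => /ltr_add_invr[N].
  by rewrite ltr_pdivlMr // ltNge (Zbnd N _ (gN0 N) (Z_g N)).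
- move=> h; apply: inner_ext => l.
  rewrite (Zrec (J h) 0 l 0 (inner l (Z0 h))) ?linear0l ?addr0 // => n.
  by have [_ -> _] := Z_P n.+1; rewrite linear0l addr0.
- move=> k l; rewrite (Zrec k 0 (V l) 0 (inner l (D k))) ?linear0l ?addr0 // => n.
  by have [_ _ ->] := Z_P n.+1; rewrite linear0l addr0.
Qed.

(** * Extension of intertwining operators *)

(** The injectivity of the coisometry [V^*]: in adjoint-free form, [Z0] satisfies
    [V^* Z0 = Z0 C0] on the invariant subspace [J H], where [C] acts as [C0], and
    [V^* Z = Z C].  Parrott's theorem applies to each [D = Z_n C] because [Z_n]
    extends [Z0]. *)
Lemma intertwining_extension H K L (J : boundedOp H K) (V : boundedOp L L)
    (C : boundedOp K K) (C0 : H -> H) (Z0 : boundedOp H L) (g : R) :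
  isometric J -> isometric V -> 0 <= g ->
  (forall h, nrm (Z0 h) <= g * nrm h) -> (forall k, nrm (C k) <= nrm k) ->
  (forall h, C (J h) = J (C0 h)) ->
  (forall h l, inner (V l) (Z0 h) = inner l (Z0 (C0 h))) ->
  exists Z : boundedOp K L, [/\ forall k, nrm (Z k) <= g * nrm k,
    forall h, Z (J h) = Z0 h & forall k l, inner (V l) (Z k) = inner l (Z (C k))].
Proof.
move=> Jiso Viso g0 Z0g C1 CJ compat.
pose G (Z : boundedOp K L) := (forall k, nrm (Z k) <= g * nrm k) /\ forall h, Z (J h) = Z0 h.
pose rel (Z Z' : boundedOp K L) := forall k l, inner (V l) (Z' k) = inner l (Z (C k)).
have step Z : G Z -> exists Z', G Z' /\ rel Z Z'.
  move=> [Zg ZJ].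
  have [||Z' [Z'g Z'J Z'V]] := @parrott H K L L J V Z0 (Z \o C) g Jiso Viso g0 Z0g.
  - by move=> k /=; rewrite (le_trans (Zg _)) // ler_wpM2l.
  - by move=> h l /=; rewrite CJ ZJ.
  by exists Z'.
(* compose Z0 with the orthogonal projection onto the subspace *)
have [Zi GZi] : exists Z, G Z.
  have J1 x : nrm (J x) <= 1 * nrm x by rewrite mul1r isometric_nrm.
  have [J' [JJ' _ J'1]] := adjoint_op_exists ler01 J1.
  exists (Z0 \o J'); split=> [k|h] /=.
    by rewrite (le_trans (Z0g _)) // ler_wpM2l // -[leRHS]mul1r.
  by congr (Z0 _); apply: inner_ext => l; rewrite -JJ' isometric_inner.
have [Z_ Z_P] := dependent_choice_in GZi step.
have [Z [Zbnd Zrec]] := operator_banach_limit g0 (fun n => (Z_P n).1.1).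
exists Z; split.
- by apply: (Zbnd 0%N) => // n; exact: (Z_P _).1.1.
- move=> h; apply: inner_ext => l.
  rewrite (Zrec (J h) 0 l 0 (inner l (Z0 h))) ?linear0l ?addr0 // => n.
  by rewrite (Z_P n.+1).1.2 linear0l addr0.
- move=> k l; rewrite (Zrec k (C k) (V l) l 0) ?add0r // => n.
  by rewrite add0r (Z_P n).2.
Qed.

End extension.

Theorem theorem6p2 (R : realType) (H K1 K2 : hilbertType R)
    (J1 : {linear H -> K1}) (J2 : {linear H -> K2})
    (J1_isometric : isometric J1) (J2_isometric : isometric J2)
    (Q T1 T2 X : boundedOp H H)
    (T1_contraction : contractive T1) (T2_contraction : contractive T2)
    (T2Q_contraction : contractive (T2 \o Q))
    (XT1_eq : X \o T1 = T2 \o Q \o X)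
    (V1 : boundedOp K1 K1) (V2 : boundedOp K2 K2)
    (V1_isometric : isometric V1) (V1_lift : is_lift J1 J1 T1 V1)
    (V2_isometric : isometric V2) (V2_lift : is_lift J2 J2 T2 V2)
    (Qbar : boundedOp K2 K2) (Qbar_lift : is_lift J2 J2 Q Qbar)
    (V2Qbar_contraction : contractive (V2 \o Qbar)) :
  exists Y : boundedOp K1 K2,
    [/\ is_lift J1 J2 X Y, opnorm Y = opnorm X & Y \o V1 = V2 \o Qbar \o Y].
Proof.
have J1b x : nrm (J1 x) <= 1 * nrm x by rewrite mul1r isometric_nrm.
have J2b x : nrm (J2 x) <= 1 * nrm x by rewrite mul1r isometric_nrm.
have [J1' J1E] := boundedOp_of (linearP J1) J1b.
have [J2' J2E] := boundedOp_of (linearP J2) J2b.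
have W1 k : nrm (V2 (Qbar k)) <= 1 * nrm k.
  apply: le_trans (opnorm_nrm (V2 \o Qbar) k) _.
  by rewrite ler_wpM2r ?nrm_ge0.
have [C [CE _ C1]] := @adjoint_op_exists _ _ _ (V2 \o Qbar) 1 ler01 W1.
have g0 := opnorm_ge0 X.
have [X' [XX' _ X'g]] := adjoint_op_exists g0 (opnorm_nrm X).
have X'E h : X' h = adjoint X h.
  by apply: inner_ext => l; rewrite -XX' adjointP.
have J1iso : isometric J1' by rewrite J1E.
have J2iso : isometric J2' by rewrite J2E.
(* C restricts to (T2 Q)^* on the image of J2 *)
pose C0 h := adjoint Q (adjoint T2 h).
have [||||Z [Zg ZJ ZV]] := @intertwining_extension _ H K2 K1 J2' V1 C C0 (J1' \o X') _
  J2iso V1_isometric g0.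
- by move=> h /=; rewrite isometric_nrm.
- by move=> k; rewrite -[leRHS]mul1r.
- move=> h; apply: inner_ext => l.
  by rewrite -CE J2E /= adjointP V2_lift adjointP Qbar_lift.
- move=> h l /=; rewrite J1E adjointP V1_lift; congr (inner l (J1 _)).
  apply: inner_ext => x; rewrite -adjointP -!XX' /C0 -!adjointP.
  by have /(congr1 (@^~ x)) /= -> := XT1_eq.
have [Y [_ ZY Yg]] := adjoint_op_exists g0 Zg.
have YJ x h : inner (Y x) (J2 h) = inner x (J1 (adjoint X h)).
  by rewrite -ZY -J2E ZJ /= J1E X'E.
exists Y; split.
- by move=> h; apply: inner_ext => l; rewrite -adjointP YJ.
(* X = J2^* Y J1, hence the norm of Y is not smaller than that of X *)
- apply/eqP; rewrite eq_le opnorm_le //=; apply: opnorm_le; first exact: opnorm_ge0.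
  move=> x; apply: nrm_le_inner; last by rewrite mulr_ge0 ?opnorm_ge0 ?nrm_ge0.
  rewrite {1}adjointP -(isometric_inner J1_isometric) -YJ.
  rewrite (le_trans (Re_inner_le _ _)) // (isometric_nrm J2_isometric) ler_wpM2r ?nrm_ge0 //.
  by rewrite (le_trans (opnorm_nrm _ _)) // (isometric_nrm J1_isometric).
- apply/funext => x /=; apply: inner_extl => k.
  by rewrite -ZY ZV ZY -CE.
Qed.
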